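(* Suppose there is a $d\times n$ complex ETF. Then, for infinitely many pairwise coprime prime powers $q$, there is an ETF of $n$ vectors in a unitary geometry on $\mathbb{F}_{q^2}^d$.
   Context: A $d\times n$ complex ETF (equiangular tight frame) is a matrix $\Phi=[\varphi_1\ \cdots\ \varphi_n]\in\mathbb{C}^{d\times n}$ with $\Phi\Phi^*=cI$ for some $c>0$, whose columns are equal-norm nonzero vectors spanning equiangular lines: there is $b\in[0,1)$ such that the unit-norm rescalings $\psi_j$ of $\varphi_j$ satisfy $|\langle\psi_i,\psi_j\rangle|^2=b$ for all $i\ne j$. A unitary geometry on $\mathbb{F}_{q^2}^d$ is a nondegenerate form $\langle\cdot,\cdot\rangle$ on this space, linear in the second variable, with $\langle u,v\rangle=\langle v,u\rangle^q$. An ETF of $n$ vectors in a unitary geometry on $V=\mathbb{F}_{q^2}^d$ is a sequence $\{\varphi_j\}_{j=1}^n$ spanning $V$ such that for some $a,b,c\in\mathbb{F}_q$: $\langle\varphi_j,\varphi_j\rangle=a$ for all $j$; $\langle\varphi_i,\varphi_j\rangle\langle\varphi_j,\varphi_i\rangle=b$ for all $i\neq j$; and $\sum_{j=1}^n\langle\varphi_j,v\rangle\varphi_j=cv$ for all $v\in V$. *)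

(* Defs.v *)
From mathcomp Require Import all_boot all_order all_algebra.
From mathcomp Require Import sesquilinear spectral.
From mathcomp Require Import classical_sets cardinality reals.
From mathcomp Require Import complex.
Set Implicit Arguments.
Unset Strict Implicit.
Unset Printing Implicit Defensive.
Import Order.TTheory GRing.Theory Num.Theory.
Local Open Scope ring_scope.
Local Open Scope complex_scope.

Section ComplexETF.
Context {R : realType}.

(* The star below is the conjugate transpose, so [cdot] is conjugate-linear in
   its first argument and linear in the second. *)
Definition cdot d (u v : 'cV[R[i]]_d) : R[i] := ((u ^t* )%sesqui *m v) 0 0.

Definition cnorm d (u : 'cV[R[i]]_d) : R[i] := sqrtC (cdot u u).

Definition normalize d (u : 'cV[R[i]]_d) : 'cV[R[i]]_d := (cnorm u)^-1 *: u.

Definition complex_tight d n (Phi : 'M[R[i]]_(d, n)) : Prop :=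
  exists2 c : R, 0 < c & Phi *m (Phi ^t* )%sesqui = (c%:C)%:M.

Definition complex_equiangular d n (Phi : 'M[R[i]]_(d, n)) : Prop :=
  exists2 b : R, 0 <= b < 1 &
    forall i j : 'I_n, i != j ->
      `|cdot (normalize (col i Phi)) (normalize (col j Phi))| ^+ 2 = b%:C.

Definition complex_ETF d n (Phi : 'M[R[i]]_(d, n)) : Prop :=
  [/\ complex_tight Phi,
      forall j, col j Phi != 0,
      forall i j, cnorm (col i Phi) = cnorm (col j Phi)
    & complex_equiangular Phi].

End ComplexETF.

Section UnitaryETF.
Context {F : finFieldType}.

(* When F has q ^ 2 elements, its subfield with q elements is the fixed field
   of the automorphism x |-> x ^+ q. *)
Definition in_Fq (q : nat) (x : F) : Prop := x ^+ q = x.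

Definition unitary_geometry (q d : nat)
    (B : 'cV[F]_d -> 'cV[F]_d -> F) : Prop :=
  [/\ forall u, scalar (B u),
      forall u v, B u v = B v u ^+ q
    & forall u, (forall v, B u v = 0) -> u = 0].

Definition unitary_ETF (q d n : nat) (B : 'cV[F]_d -> 'cV[F]_d -> F)
    (phi : 'I_n -> 'cV[F]_d) : Prop :=
  (<<[seq phi j | j : 'I_n]>> = fullv)%VS /\
  exists a b c : F,
    [/\ [/\ in_Fq q a, in_Fq q b & in_Fq q c],
        forall j, B (phi j) (phi j) = a,
        forall i j, i != j -> B (phi i) (phi j) * B (phi j) (phi i) = b
      & forall v, \sum_(j < n) B (phi j) v *: phi j = c *: v].

End UnitaryETF.

Definition prime_power (q : nat) : Prop :=
  exists p k : nat, [/\ prime p, (0 < k)%N & q = (p ^ k)%N].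

Definition has_unitary_ETF (q d n : nat) : Prop :=
  exists F : finFieldType, #|F| = (q ^ 2)%N /\
    exists B : 'cV[F]_d -> 'cV[F]_d -> F, unitary_geometry q B /\
      exists phi : 'I_n -> 'cV[F]_d, unitary_ETF q B phi.

(* Main.v *)
(** A complex ETF is a real solution of polynomial equations over the integers
    in the real and imaginary parts of its entries.  Such a solution can first
    be replaced by a real algebraic one: adjoin the coordinates one at a time;
    a coordinate satisfying no relation over the previous ones becomes a nearby
    rational, and otherwise its minimal polynomial changes sign nearby, so the
    intermediate value theorem provides a nearby algebraic root.  The new
    coordinates lie in Q(theta) for some real theta, a simple root of an integer
    polynomial f.  Instead of Chebotarev's theorem, an Euclid style argument
    suffices: as f changes sign, it takes suitable values which are f(0) times a
    negative integer congruent to 1 modulo 4, so that f has a root modulo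
    infinitely many primes p congruent to 3 modulo 4.  Reducing modulo p sends
    the equations to 'F_p; since -1 has no square root there, complex conjugation
    becomes the Frobenius automorphism of the field with p ^ 2 elements. *)
Require Import Defs.
From HB Require Import structures.
From mathcomp Require Import all_boot all_order all_algebra all_field.
From mathcomp Require Import polyorder polyrcf realalg.
From mathcomp Require Import ring lra zify.
From mathcomp Require Import boolp classical_sets cardinality reals complex.
Set Implicit Arguments.
Unset Strict Implicit.
Unset Printing Implicit Defensive.
Import Order.TTheory GRing.Theory Num.Theory.
Local Open Scope ring_scope.

(** * Rational points and sign changes of polynomials *)

(* Clears the denominator of a fraction: over a field this is
   [b ^+ n * p.[a / b]], so that a condition on [p] at a rational point can be
   expressed by an element of the coefficient ring [A]. *)
Definition homog (A : comNzRingType) (n : nat) (p : {poly A}) (a b : A) : A :=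
  \sum_(i < n.+1) p`_i * a ^+ i * b ^+ (n - i).

Lemma rmorph_homog (A B : comNzRingType) (f : {rmorphism A -> B}) n p a b :
  f (homog n p a b) = homog n (map_poly f p) (f a) (f b).
Proof.
rewrite rmorph_sum; apply: eq_bigr => i _.
by rewrite !rmorphM !rmorphXn coef_map.
Qed.

Lemma homogE (F : fieldType) n (p : {poly F}) a b :
  b != 0 -> (size p <= n.+1)%N -> homog n p a b = b ^+ n * p.[a / b].
Proof.
move=> b0 sp; rewrite (horner_coef_wide _ sp) mulr_sumr.
apply: eq_bigr => i _; rewrite expr_div_n.
have -> : b ^+ n = b ^+ i * b ^+ (n - i) by rewrite -exprD subnKC // -ltnS.
by field; rewrite expf_neq0.
Qed.

(** When [c] selects the positive coefficients, this part is nondecreasing on the nonnegative reals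
    and the part for [predC c] is nonincreasing. *)
Definition mask_poly (A : nzRingType) (c : pred nat) (p : {poly A}) :=
  \poly_(i < size p) (if c i then p`_i else 0).

Lemma coef_mask_poly (A : nzRingType) (c : pred nat) (p : {poly A}) i :
  (mask_poly c p)`_i = if c i then p`_i else 0.
Proof.
rewrite coef_poly; case: ltnP => // sp; case: ifP => // _.
by rewrite nth_default.
Qed.

Lemma size_mask_poly (A : nzRingType) (c : pred nat) (p : {poly A}) :
  (size (mask_poly c p) <= size p)%N.
Proof. exact: size_poly. Qed.

Lemma mask_polyDC (A : nzRingType) (c : pred nat) (p : {poly A}) :
  mask_poly c p + mask_poly (predC c) p = p.
Proof.
apply/polyP => i; rewrite coefD !coef_mask_poly /=.
by case: (c i); rewrite ?addr0 ?add0r.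
Qed.

Lemma ler_horner (K : numDomainType) (p : {poly K}) (x y : K) :
  (forall i, 0 <= p`_i) -> 0 <= x -> x <= y -> p.[x] <= p.[y].
Proof.
move=> p0 x0 xy; rewrite !horner_coef; apply: ler_sum => i _.
by rewrite ler_wpM2l // lerXn2r // nnegrE // (le_trans x0).
Qed.

Lemma rational_bracket (K : archiRealFieldType) (z d : K) : 0 < z -> 0 < d ->
  exists k l e : nat, [/\ (0 < e)%N, z - d < k%:R / e%:R, k%:R / e%:R < z,
    z < l%:R / e%:R & l%:R / e%:R < z + d].
Proof.
(* The bracket has width [2 / e < d], and [z^-1 < e] makes the floor of [z * e] positive. *)
move=> z0 d0; pose e := (Num.bound (2 / d) + Num.bound z^-1)%N.
have e1 : 2 / d < e%:R.
  rewrite natrD ltr_wpDr ?ler0n // archi_boundP // divr_ge0 // ltW //.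
have e2 : z^-1 < e%:R.
  by rewrite natrD ltr_wpDl ?ler0n // archi_boundP // invr_ge0 ltW.
have e0 : 0 < e%:R :> K by apply: lt_trans e2; rewrite invr_gt0.
have de : 2 < d * e%:R by rewrite mulrC -ltr_pdivrMr.
have ze : 1 < z * e%:R by rewrite mulrC -ltr_pdivrMr // div1r.
have /truncn_itv/andP[t1 t2] : 0 <= z * e%:R by rewrite (le_trans _ (ltW ze)).
have t0 : (0 < Num.truncn (z * e%:R))%N.
  by rewrite truncn_gt0 ltW.
move: {e1 e2}e e0 de ze t0 t1 t2 => e e0 de ze.
case: (Num.truncn _) => // k _ t1 t2.
(* The floor of [z * e] is [k.+1]; stepping down by one keeps the left inequality strict when
   [z * e] is an integer. *)
exists k, k.+2, e; split; first by rewrite -(ltr0n K).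
- rewrite ltr_pdivlMr // mulrBl; move: t2; rewrite -(@natr1 K k.+1) -(@natr1 K k); lra.
- rewrite ltr_pdivrMr //; move: t1; rewrite -(@natr1 K k); lra.
- by rewrite ltr_pdivlMr.
- rewrite ltr_pdivrMr // mulrDl; move: t1; rewrite -(@natr1 K k.+1) -(@natr1 K k); lra.
Qed.

Lemma horner_gt0_near (K : rcfType) (p : {poly K}) (z : K) : 0 < p.[z] ->
  exists2 d : K, 0 < d & forall y : K, `|y - z| < d -> 0 < p.[y].
Proof.
move=> pz; have [d d0 hd] := poly_cont z p pz.
by exists d => // y /hd; rewrite ltr_norml; lra.
Qed.

(** Write [p = q * ('X - z)]: the value of [q] at [z] is that of the derivative of [p], so [q] keeps
    its sign nearby while the linear factor changes sign. *)
Lemma simple_root_sign_change (K : rcfType) (p : {poly K}) (z : K) :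
  root p z -> ~~ root p^`() z ->
  exists2 d : K, 0 < d & forall x y : K, z - d < x < z -> z < y < z + d ->
    p.[x] * p.[y] < 0.
Proof.
move=> /factor_theorem[q ->]; rewrite derivM derivXsubC mulr1 rootE !hornerE.
rewrite subrr mulr0 add0r => qz.
have : 0 < (q.[z] *: q).[z] by rewrite hornerZ -expr2 exprn_even_gt0.
move=> /horner_gt0_near[d d0 hd].
exists d => // x y /andP[x1 x2] /andP[y1 y2]; rewrite !hornerM !hornerXsubC.
have hx : 0 < (q.[z] *: q).[x] by apply: hd; rewrite ltr_norml; lra.
have hy : 0 < (q.[z] *: q).[y] by apply: hd; rewrite ltr_norml; lra.
move: hx hy; rewrite !hornerZ => hx hy.
have h : 0 < q.[x] * q.[y].
  have := mulr_gt0 hx hy; rewrite mulrACA pmulr_rgt0 //.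
  by rewrite -expr2 exprn_even_gt0.
by rewrite mulrACA pmulr_rlt0 //; nra.
Qed.

(** [P] has least size among the polynomials over [A] with nonzero image vanishing at [z].
    Minimality is taken over [A], not [K], so that pseudo-division by [P] stays in [{poly A}]. *)
Lemma minimal_annihilator (A : idomainType) (K : realFieldType)
    (ev : {rmorphism A -> K}) (z : K) :
  (exists2 s, map_poly ev s != 0 & root (map_poly ev s) z) ->
  exists P : {poly A}, [/\ ev (lead_coef P) != 0, root (map_poly ev P) z,
    ~~ root (map_poly ev P)^`() z &
    forall s, root (map_poly ev s) z -> map_poly ev (s %% P) = 0].
Proof.
move=> [s s0 sz].
have : exists P, [/\ map_poly ev P != 0, root (map_poly ev P) z &
   forall s : {poly A}, (size s < size P)%N ->
     root (map_poly ev s) z -> map_poly ev s = 0].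
  have [n] := ubnP (size s); elim: n => // n IH in s s0 sz *; rewrite ltnS => sn.
  have [[t [ts t0 tz]]|h] := pselect
    (exists t : {poly A}, [/\ (size t < size s)%N, map_poly ev t != 0
       & root (map_poly ev t) z]).
    by apply: IH tz _ => //; apply: leq_trans sn.
  exists s; split=> // t ts tz; apply/eqP/negP => t0; apply: h; exists t; split=> //.
  exact/negP.
move=> {s s0 sz} [P [P0 Pz Pmin]].
(* If [ev] killed the leading coefficient, the truncation of [P] would have the same image and a
   smaller size. *)
have lcP : ev (lead_coef P) != 0.
  apply/eqP => lc0; have sP : (0 < size P)%N.
    by rewrite size_poly_gt0; apply: contraNneq P0 => ->; rewrite rmorph0.
  have E : map_poly ev (take_poly (size P).-1 P) = map_poly ev P.
    apply/polyP => i; rewrite !coef_map coef_take_poly /=.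
    case: ltnP => // iP; rewrite rmorph0.
    move: iP; rewrite leq_eqVlt => /orP[/eqP<-|iP]; first by rewrite -lead_coefE.
    by rewrite nth_default ?rmorph0 // -(prednK sP).
  have := Pmin (take_poly (size P).-1 P); rewrite E => /(_ _ Pz) P0'.
  by rewrite P0' ?eqxx // in P0; rewrite -{2}(prednK sP) ltnS size_take_poly.
have sP : size (map_poly ev P) = size P by rewrite size_map_poly_id0.
exists P; split=> //.
  (* By minimality, a derivative vanishing at [z] would have zero image; in characteristic 0 the
     image of [P] would be a constant with a root, hence zero. *)
  rewrite deriv_map; apply/negP => /Pmin; rewrite lt_size_deriv; last first.
    by apply: contraNneq P0 => ->; rewrite rmorph0.
  move=> /(_ isT); rewrite -deriv_map => /eqP; rewrite -size_poly_eq0 size_deriv.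
  rewrite -subn1 subn_eq0 => /size1_polyC E.
  move: Pz P0; rewrite E rootC => /eqP->; by rewrite polyC0 eqxx.
move=> s sz; apply: Pmin.
  rewrite Pdiv.Idomain.ltn_modp; by apply: contraNneq P0 => ->; rewrite rmorph0.
have /(congr1 (fun p => (map_poly ev p).[z])) := Pdiv.Idomain.divp_eq s P.
rewrite rmorphD rmorphM /= map_polyZ /= hornerD hornerM hornerZ.
by rewrite (rootP sz) (rootP Pz) !mulr0 add0r => /esym/rootP.
Qed.

(** * Sign-preserving specialization to real algebraic numbers *)

(** The extension of [f] sending ['X] to [z]. It is again a morphism and can be extended in turn,
    which is how variables are adjoined one at a time. *)
Definition evalp (A B : comNzRingType) (f : {rmorphism A -> B}) (z : B) :
  {poly A} -> B := horner_eval z \o map_poly f.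
HB.instance Definition _ (A B : comNzRingType) (f : {rmorphism A -> B}) (z : B) :=
  GRing.RMorphism.copy (evalp f z) (horner_eval z \o map_poly f).

Lemma evalpE (A B : comNzRingType) (f : {rmorphism A -> B}) (z : B) p :
  evalp f z p = (map_poly f p).[z].
Proof. by []. Qed.

Lemma common_radius (K : realDomainType) (T : eqType) (U : seq T)
    (Q : T -> K -> Prop) :
  (forall u d d', d <= d' -> Q u d' -> Q u d) ->
  (forall u, u \in U -> exists2 d, 0 < d & Q u d) ->
  exists2 d, 0 < d & forall u, u \in U -> Q u d.
Proof.
move=> Qle; elim: U => [|v U IH] hU; first by exists 1.
have [|d d0 hd] := IH; first by move=> u uU; apply: hU; rewrite inE uU orbT.
have [|d' d'0 hd'] := hU v; first by rewrite mem_head.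
exists (Num.min d d'); first by rewrite lt_min d0.
move=> u; rewrite inE => /predU1P[->|uU].
  by apply: Qle hd'; rewrite ge_min lexx orbT.
by apply: Qle (hd _ uU); rewrite ge_min lexx.
Qed.

(* The positive-coefficient part of [u] evaluated at the left endpoint plus the
   rest evaluated at the right endpoint bounds [u] from below on [[x, y]]; unlike
   positivity of [u] on an interval, positivity of this bound is a single strict
   inequality. *)
Lemma masked_value_gt0_near (A : comNzRingType) (K : rcfType)
    (ev : {rmorphism A -> K}) (c : pred nat) (u : {poly A}) (z : K) :
  0 < evalp ev z u ->
  exists2 d : K, 0 < d & forall x y : K, z - d < x < z -> z < y < z + d ->
    0 < evalp ev x (mask_poly c u) + evalp ev y (mask_poly (predC c) u).
Proof.
rewrite -{1}[u](mask_polyDC c) rmorphD /= !evalpE /=.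
set p := map_poly ev _; set q := map_poly ev _ => h.
have h2 : 0 < (p.[z] + q.[z]) / 2 by rewrite divr_gt0.
have [d1 d10 hd1] := poly_cont z p h2; have [d2 d20 hd2] := poly_cont z q h2.
exists (Num.min d1 d2) => [|x y /andP[x1 x2] /andP[y1 y2]]; first by rewrite lt_min d10.
have m1 : Num.min d1 d2 <= d1 by rewrite ge_min lexx.
have m2 : Num.min d1 d2 <= d2 by rewrite ge_min lexx orbT.
have {hd1} : `|p.[x] - p.[z]| < (p.[z] + q.[z]) / 2.
  by apply: hd1; rewrite ltr_norml; lra.
have {hd2} : `|q.[y] - q.[z]| < (p.[z] + q.[z]) / 2.
  by apply: hd2; rewrite ltr_norml; lra.
rewrite !evalpE -/p -/q !ltr_norml => /andP[h4 _] /andP[h5 _]; lra.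
Qed.

(** On nonnegative arguments the part of [u] selected by [c] grows and the rest decreases, so each
    is bounded below by its value at the appropriate end. *)
Lemma masked_value_le (A : comNzRingType) (K : realFieldType)
    (f : {rmorphism A -> K}) (c : pred nat) (u : {poly A}) (x w y : K) :
  0 <= x -> x <= w -> w <= y ->
  (forall i, c i -> 0 <= f u`_i) -> (forall i, ~~ c i -> f u`_i <= 0) ->
  evalp f x (mask_poly c u) + evalp f y (mask_poly (predC c) u) <= evalp f w u.
Proof.
move=> x0 xw wy cp cn; rewrite -{3}[u](mask_polyDC c) rmorphD /= !evalpE lerD //.
  apply: ler_horner => // i; rewrite coef_map coef_mask_poly /=.
  by case: ifP => [/cp|] //; rewrite rmorph0.
rewrite -lerN2 -!hornerN; apply: ler_horner => //; last exact: le_trans xw.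
move=> i; rewrite coefN coef_map coef_mask_poly /= oppr_ge0.
by case: ifP => [/cn|] //; rewrite rmorph0.
Qed.

Lemma evalp_homog (A : comNzRingType) (K : realFieldType)
    (f : {rmorphism A -> K}) n (p : {poly A}) (a e : nat) :
  (0 < e)%N -> (size p <= n.+1)%N ->
  f (homog n p a%:R e%:R) = e%:R ^+ n * evalp f (a%:R / e%:R) p.
Proof.
move=> e0 sp; rewrite rmorph_homog !rmorph_nat homogE ?evalpE //.
  by rewrite pnatr_eq0 -lt0n.
exact: leq_trans (size_poly _ _) sp.
Qed.

(** The strict inequalities serve the induction on variables: a root in the next variable is forced
    by a sign change, which is an inequality in the previous ones. *)
Definition real_specializable (R : realFieldType) (A : comNzRingType)
    (ev : A -> R) : Prop :=
  forall S U : seq A, (forall s, s \in S -> ev s = 0) ->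
    (forall u, u \in U -> 0 < ev u) ->
  exists phi : {rmorphism A -> realalg},
    (forall s, s \in S -> phi s = 0) /\ (forall u, u \in U -> 0 < phi u).

(** [S0] and [U0] are conditions on coefficients that force a common zero of [S] between [k / e] and
    [l / e]. The bracket stays free within radius [d], so that it can be shrunk further for the sake
    of other inequalities. *)
Lemma common_zero_specialization (R : realType) (A : idomainType)
    (ev : {rmorphism A -> R}) (z : R) (S : seq {poly A}) :
  0 < z -> (forall s, s \in S -> evalp ev z s = 0) ->
  exists (S0 : seq A) (U0 : nat -> nat -> nat -> seq A),
    (forall s, s \in S0 -> ev s = 0) /\
  exists2 d : R, 0 < d & forall k l e : nat, (0 < e)%N ->
    z - d < k%:R / e%:R < z -> z < l%:R / e%:R < z + d ->
    (forall u, u \in U0 k l e -> 0 < ev u) /\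
    forall phi : {rmorphism A -> realalg},
      (forall s, s \in S0 -> phi s = 0) ->
      (forall u, u \in U0 k l e -> 0 < phi u) ->
    exists w : realalg, [/\ k%:R / e%:R <= w, w <= l%:R / e%:R &
      forall s, s \in S -> evalp phi w s = 0].
Proof.
move=> z0 Sz.
have kl (k l e : nat) : (0 < e)%N -> k%:R / e%:R < z -> z < l%:R / e%:R ->
    k%:R / e%:R <= l%:R / e%:R :> realalg.
  move=> e0 h1 h2; rewrite ler_pM2r ?invr_gt0 ?ltr0n // ler_nat.
  by have := lt_trans h1 h2; rewrite ltr_pM2r ?invr_gt0 ?ltr0n // ltr_nat => /ltnW.
have [[s sS s0]|hS] := pselect (exists2 s, s \in S & map_poly ev s != 0); last first.
  (* When [ev] kills all coefficients of [S], requiring the same of [phi] makes every [w] a common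
     zero. *)
  exists (flatten [seq polyseq s | s <- S]), (fun _ _ _ => [::]).
  have S0 s : s \in S -> map_poly ev s = 0.
    by move=> sS; apply/eqP/negP => s0; apply: hS; exists s => //; apply/negP.
  split=> [s /flatten_mapP[t tS /(nthP 0)[i _ <-]]|].
    by rewrite -coef_map S0 // coef0.
  exists 1 => // k l e e0 /andP[_ h1] /andP[h2 _]; split=> // phi phi0 _.
  exists (k%:R / e%:R); split=> // [|s sS]; first exact: kl.
  rewrite evalpE; suff -> : map_poly phi s = 0 by rewrite horner0.
  apply/polyP => i; rewrite coef_map coef0 /=; have [si|si] := ltnP i (size s).
    by apply: phi0; apply/flatten_mapP; exists s => //; apply: mem_nth.
  by rewrite nth_default ?rmorph0.
have [|P [lcP Pz P'z Pmod]] := @minimal_annihilator _ _ ev z.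
  by exists s => //; apply/rootP; apply: Sz.
have [d d0 hd] := simple_root_sign_change Pz P'z.
pose n := size P.
(* The pseudo-remainders by [P] must vanish, its leading coefficient must not, and [P] must change
   sign across the bracket. *)
exists (flatten [seq polyseq (s %% P) | s <- S]), (fun k l e =>
  [:: lead_coef P ^+ 2; - (homog n P k%:R e%:R * homog n P l%:R e%:R)]).
split=> [t /flatten_mapP[t' tS /(nthP 0)[i _ <-]]|].
  by rewrite -coef_map Pmod ?coef0 //; apply/rootP; apply: Sz.
exists d => // k l e e0 h1 h2.
have homP (K : realFieldType) (f : {rmorphism A -> K}) :
    (0 < f (- (homog n P k%:R e%:R * homog n P l%:R e%:R))) =
    (evalp f (k%:R / e%:R) P * evalp f (l%:R / e%:R) P < 0).
  rewrite rmorphN rmorphM /= !evalp_homog // oppr_gt0 mulrACA -expr2.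
  by rewrite pmulr_rlt0 // exprn_gt0 // exprn_gt0 // ltr0n.
split=> [u|phi phi0 phiU].
  rewrite !inE => /orP[/eqP->|/eqP->]; last by rewrite homP; apply: hd.
  by rewrite rmorphXn /= exprn_even_gt0.
have := phiU _ (mem_head _ _).
rewrite rmorphXn /= exprn_even_gt0 //= => lc0.
have : evalp phi (k%:R / e%:R) P * evalp phi (l%:R / e%:R) P < 0.
  by rewrite -homP; apply: phiU; rewrite !inE eqxx orbT.
have {kl} : k%:R / e%:R <= l%:R / e%:R :> realalg.
  by case/andP: h1 => _ h1; case/andP: h2 => h2 _; apply: kl.
rewrite !evalpE => le_kl /(poly_ivtoo le_kl)[w]; rewrite in_itv /= => /andP[kw wl] Pw.
exists w; split; try exact: ltW.
(* At the root [w] of [P], pseudo-division equates a power of the leading coefficient times [t] with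
   the remainder, which is zero. *)
move=> t tS; have /(congr1 (evalp phi w)) := Pdiv.Idomain.divp_eq t P.
rewrite -mul_polyC rmorphD !rmorphM /= !evalpE map_polyC hornerC (rootP Pw) mulr0 add0r.
suff -> : map_poly phi (t %% P) = 0.
  have lcn : phi (lead_coef P ^+ scalp t P) != 0 by rewrite rmorphXn expf_neq0.
  by rewrite horner0 => /eqP; rewrite mulf_eq0 => /orP[|/eqP//]; rewrite (negPf lcn).
apply/polyP => i; rewrite coef_map coef0 /=; have [si|si] := ltnP i (size (t %% P)).
  by apply: phi0; apply/flatten_mapP; exists t => //; apply: mem_nth.
by rewrite nth_default ?rmorph0.
Qed.

(** The new variable goes to a common zero [w] known only to lie in the bracket. Positivity of each
    [u] at [w] follows from the lower bound by values at the two ends, whose positivity is an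
    inequality over [A]. *)
Lemma real_specializable_poly (R : realType) (A : idomainType)
    (ev : {rmorphism A -> R}) (z : R) :
  0 < z -> real_specializable ev -> real_specializable (evalp ev z).
Proof.
move=> z0 spA S U Sz Uz.
have [S0 [U0 [S0z [d1 d10 hd1]]]] := common_zero_specialization z0 Sz.
pose c (u : {poly A}) i := 0 < ev u`_i.
have [||d2 d20 hd2] := @common_radius R _ U (fun u d =>
  forall x y : R, z - d < x < z -> z < y < z + d ->
  0 < evalp ev x (mask_poly (c u) u) + evalp ev y (mask_poly (predC (c u)) u)).
- move=> u d d' dd' h x y /andP[x1 x2] /andP[y1 y2]; apply: h; apply/andP; split=> //.
    by apply: le_lt_trans x1; rewrite lerD2l lerN2.
  by apply: lt_le_trans y2 _; rewrite lerD2l.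
- by move=> u uU; apply: masked_value_gt0_near; apply: Uz.
have [|k [l [e [e0 k1 k2 l1 l2]]]] := @rational_bracket R z (Num.min d1 d2) z0.
  by rewrite lt_min d10.
have m1 : Num.min d1 d2 <= d1 by rewrite ge_min lexx.
have m2 : Num.min d1 d2 <= d2 by rewrite ge_min lexx orbT.
have {hd1} [||U0z hw] := hd1 k l e e0; rewrite ?k2 ?l1 ?andbT /=; try lra.
pose C := flatten [seq polyseq u | u <- U].
pose cert (u : {poly A}) := homog (size u) (mask_poly (c u) u) k%:R e%:R +
  homog (size u) (mask_poly (predC (c u)) u) l%:R e%:R.
have certE (K : realFieldType) (f : {rmorphism A -> K}) u :
   (0 < f (cert u)) = (0 < evalp f (k%:R / e%:R) (mask_poly (c u) u) +
      evalp f (l%:R / e%:R) (mask_poly (predC (c u)) u)).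
  rewrite rmorphD /= !evalp_homog ?(leq_trans (size_mask_poly _ _)) // -mulrDr.
  by rewrite pmulr_rgt0 // exprn_gt0 // ltr0n.
(* [phi] must also keep the sign, possibly zero, of every coefficient, so that the splitting by [c]
   stays valid after specialization. *)
have [||phi [phi0 phi1]] := spA (S0 ++ [seq a <- C | ev a == 0])
  (U0 k l e ++ [seq a <- C | 0 < ev a] ++ [seq - a | a <- C & ev a < 0] ++
   [seq cert u | u <- U]).
- by move=> s; rewrite mem_cat mem_filter => /orP[/S0z|/andP[/eqP]].
- move=> u; rewrite !mem_cat mem_filter => /or4P[/U0z|/andP[]|/mapP[a]|/mapP[a aU ->]] //.
    by rewrite mem_filter => /andP[a0 _] ->; rewrite rmorphN oppr_gt0.
  by rewrite certE; apply: hd2 => //; rewrite ?k2 ?l1 ?andbT /=; lra.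
have [||w [kw wl wS]] := hw phi.
- by move=> s sS; apply: phi0; rewrite mem_cat sS.
- by move=> u uU; apply: phi1; rewrite mem_cat uU.
exists (evalp phi w : {rmorphism _ -> _}); split=> //= u uU.
have : 0 < phi (cert u) by apply: phi1; rewrite !mem_cat map_f ?orbT.
rewrite certE => /lt_le_trans; apply; apply: masked_value_le => //.
  by rewrite divr_ge0 ?ler0n.
- move=> i ci; have [si|si] := ltnP i (size u); last by rewrite nth_default ?rmorph0.
  apply/ltW/phi1; rewrite !mem_cat mem_filter [0 < ev _]ci /=.
  by apply/or4P; constructor 2; apply/flatten_mapP; exists u => //; apply: mem_nth.
- move=> i ci; have [si|si] := ltnP i (size u); last by rewrite nth_default ?rmorph0.
  have iC : u`_i \in C by apply/flatten_mapP; exists u => //; apply: mem_nth.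
  have : ev u`_i <= 0 by rewrite leNgt.
  rewrite le_eqVlt => /orP[ui|ui].
    by rewrite phi0 // mem_cat mem_filter ui iC orbT.
  rewrite -oppr_ge0 -rmorphN; apply/ltW/phi1; rewrite !mem_cat.
  by apply/or4P; constructor 3; apply: map_f; rewrite mem_filter ui.
Qed.

(** * Primes congruent to 3 modulo 4 with a root of a given polynomial *)

(** The least prime factor is odd; if it is 1 modulo 4, the cofactor is smaller and again 3 modulo
    4. *)
Lemma prime_dvd_3mod4 (n : nat) : (n %% 4 = 3)%N ->
  exists p, [/\ prime p, (p %% 4 = 3)%N & (p %| n)%N].
Proof.
have [m] := ubnP n; elim: m n => // m IH n; rewrite ltnS => nm n3.
have n1 : (1 < n)%N by case: n n3 {nm} => [|[|]].
have pn := pdiv_dvd n; have pp := pdiv_prime n1.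
move: (pn) => /dvdnP[k nE].
have [p3|p3] := eqVneq (pdiv n %% 4)%N 3; first by exists (pdiv n).
have [||q [q1 q2 q3]] := IH k; last by exists q; split=> //; rewrite nE dvdn_mulr.
  have := prime_gt1 pp; have : (0 < k)%N by case: k nE n1 => [->|].
  by move: nE; set p := pdiv n => nE k0 p1; apply: leq_trans nm; rewrite nE ltn_Pmulr.
move: n3 p3; rewrite {1}nE -modnMm.
have := ltn_pmod k (isT : 0 < 4)%N; have := ltn_pmod (pdiv n) (isT : 0 < 4)%N.
by case: (k %% 4)%N => [|[|[|[|]]]] //; case: (pdiv n %% 4)%N => [|[|[|[|]]]].
Qed.

Lemma expr_1mod (A : comNzRingType) (a t : A) n :
  exists s, (1 + a * t) ^+ n = 1 + a * s.
Proof.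
elim: n => [|n [s IH]]; first by exists 0; rewrite expr0 mulr0 addr0.
by exists (s + t + t * a * s); rewrite exprS IH; ring.
Qed.

Lemma homogS (A : comNzRingType) n (p : {poly A}) (a b : A) :
  exists s, homog n p a b = p`_0 * b ^+ n + a * s.
Proof.
exists (\sum_(i < n) p`_i.+1 * a ^+ i * b ^+ (n - i.+1)).
rewrite /homog big_ord_recl /= expr0 mulr1 subn0 mulr_sumr; congr (_ + _).
by apply: eq_bigr => i _; rewrite /bump /= add1n exprS; ring.
Qed.

Lemma homog0 (A : comNzRingType) n (p : {poly A}) (a : A) :
  homog n p a 0 = p`_n * a ^+ n.
Proof.
rewrite /homog big_ord_recr /= subnn expr0 mulr1 big1 ?add0r // => i _.
by rewrite expr0n subn_eq0 leqNgt ltn_ord mulr0.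
Qed.

(** The fraction is [L * m / l + L / l ^ 2]: the first term lies between [x - L / l] and [x], the
    second is positive and at most [L / l < d]. *)
Lemma floor_approx (F : realFieldType) (L l m x d : F) :
  0 < L -> 1 <= l -> 0 < d -> m * L <= x * l -> x * l < (m + 1) * L ->
  L < d * l -> `|L * (1 + l * m) / (l * l) - x| < d.
Proof.
move=> L0 l1 d0 h1 h2 hl; have l0 : 0 < l by apply: lt_le_trans l1.
have ll : 0 < l * l by rewrite mulr_gt0.
have -> : L * (1 + l * m) / (l * l) - x = (L + l * (m * L - x * l)) / (l * l).
  by field; rewrite lt0r_neq0.
rewrite ltr_norml ltr_pdivlMr // ltr_pdivrMr //; apply/andP; split.
  have : l * (x * l - m * L) < l * L by rewrite ltr_pM2l //; lra.
  have : l * L < l * (d * l) by rewrite ltr_pM2l.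
  lra.
have : l * (m * L - x * l) <= 0 by rewrite pmulr_rle0 //; lra.
have : 1 * (d * l) <= l * (d * l) by rewrite ler_wpM2r // mulr_ge0 ?ltW.
lra.
Qed.

(** The shape serves the Euclid argument: the numerator is divisible by [L], the denominator is 1
    modulo [L], and [1 + l * m] is prime to [l]. *)
Lemma coprime_progression_approx (x d : realalg) (L : nat) :
  0 < x -> 0 < d -> (0 < L)%N ->
  exists l m t : nat, [/\ l = (1 + L * t)%N, (0 < l)%N &
    `|L%:R * (1 + l * m)%N%:R / (l ^ 2)%N%:R - x| < d].
Proof.
move=> x0 d0 L0; have L0' : 0 < L%:R :> realalg by rewrite ltr0n.
pose t := Num.bound (2 / d); pose l := (1 + L * t)%N.
have l0 : 0 < l%:R :> realalg by rewrite ltr0n.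
have hl : L%:R < d * l%:R.
  have : 2 / d < t%:R by rewrite archi_boundP // divr_ge0 // ltW.
  rewrite ltr_pdivrMr // /l natrD natrM => h.
  have : L%:R * 2 < L%:R * (t%:R * d) by rewrite ltr_pM2l.
  nra.
have /truncn_itv/andP[] : 0 <= x * l%:R / L%:R.
  by rewrite divr_ge0 ?ler0n // mulr_ge0 ?ler0n // ltW.
move: (Num.truncn _) => m; rewrite ler_pdivlMr // ltr_pdivrMr // -natr1 => h1 h2.
exists l, m, t; split=> //.
rewrite natrD natrM -mulnn natrM.
apply: floor_approx => //.
by rewrite ler1n.
Qed.

(** At a suitable fraction near [x], the homogenized value of [f] is [c * (1 + a * s)], where [a] is
    divisible by 4, [M], [lc] and [c]. The sign hypothesis makes [1 + a * s] negative; a prime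
    dividing it cannot divide [a]. *)
Lemma prime_3mod4_root_of_opposite_sign (f : {poly int}) (x : realalg) (M : nat) :
  0 < x -> (f`_0)%:~R * (map_poly intr f).[x] < 0 -> (0 < M)%N ->
  exists p, [/\ prime p, (p %% 4 = 3)%N, ~~ (p %| M)%N &
    exists tau : 'F_p, root (map_poly intr f) tau].
Proof.
move=> x0 fx M0; set c := f`_0 in fx *; pose lc := lead_coef f.
have c0 : c != 0 by apply: contraTneq fx => ->; rewrite mul0r ltxx.
have lc0 : lc != 0.
  rewrite lead_coef_eq0; apply: contraTneq fx => ->.
  by rewrite rmorph0 horner0 mulr0 ltxx.
(* Squaring makes [L = a * c] hold without signs; the factor [c] beyond [a] is the one taken out of
   [H]. *)
pose L := (4 * M * (`|lc| * `|lc|) * (`|c| * `|c|))%N.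
have L0 : (0 < L)%N by rewrite !muln_gt0 M0 !absz_gt0 lc0 c0.
pose a : int := 4 * M%:Z * lc ^+ 2 * c.
have LE : L%:Z = a * c.
  have sq (w : int) : `|w|%N%:Z * `|w|%N%:Z = w ^+ 2.
    by rewrite -PoszM -abszM abszE ger0_norm -?expr2 ?sqr_ge0.
  by rewrite /L !PoszM !sq /a; ring.
have [|d d0 hd] := @horner_gt0_near _ (- c%:~R *: map_poly intr f) x.
  by rewrite hornerZ mulNr oppr_gt0.
have [l [m [t [lE l0 hlm]]]] := coprime_progression_approx x0 d0 L0.
pose u := (1 + l * m)%N; pose v := (l ^ 2)%N; pose n := (size f).-1.
have v0 : (0 < v)%N by rewrite expn_gt0 l0.
have sf : (size f <= n.+1)%N by rewrite leqSpred.
have {hd hlm} := hd _ hlm; rewrite hornerZ mulNr oppr_gt0 -/u -/v => fuv.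
pose H := homog n f (L%:Z * u%:Z) v%:Z.
have Hneg : c * H < 0.
  rewrite -(ltrz0 realalg) rmorphM /= rmorph_homog homogE //; last first.
  - exact: leq_trans (size_poly _ _) sf.
  - by rewrite intr_eq0 -lt0n.
  rewrite mulrCA pmulr_rlt0; last by rewrite exprn_gt0 // ltr0z ltz_nat.
  by rewrite rmorphM.
have [s HE] : exists s, H = c * (1 + a * s).
  have [s1 E1] := homogS n f (L%:Z * u%:Z) v%:Z.
  have [s2 E2] := expr_1mod a (c * t%:Z) (2 * n).
  exists (s2 + u%:Z * s1); rewrite /H E1 -/c /v.
  have -> : (l ^ 2)%N%:Z ^+ n = 1 + a * s2.
    rewrite -E2 exprM; congr (_ ^+ n); rewrite -mulnn PoszM -expr2 lE PoszD PoszM LE.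
    by rewrite mulrA.
  by rewrite LE; ring.
have Nneg : 1 + a * s < 0.
  move: Hneg; rewrite HE mulrA pmulr_rlt0 // -expr2 exprn_even_gt0 //.
(* As 4 divides [a] and [1 + a * s] is negative, its absolute value is 3 modulo 4. *)
have [|p [pp p3 pN]] := prime_dvd_3mod4 (n := absz (1 + a * s)).
  move: Nneg; rewrite /a -!mulrA; move: (M%:Z * _) => w; lia.
have pc := pchar_Fp pp.
have Np : 1 + a%:~R * s%:~R = 0 :> 'F_p.
  have -> : 1 + a%:~R * s%:~R = (1 + a * s)%:~R :> 'F_p by rewrite rmorphD rmorphM.
  have /dvdnP[k kE] := pN.
  have -> : 1 + a * s = - (k%:Z * p%:Z) by rewrite -PoszM -kE ltz0_abs ?opprK.
  by rewrite rmorphN rmorphM /= -[p%:~R]/(p%:R) (pcharf0 pc) mulr0 oppr0.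
have ap : a%:~R != 0 :> 'F_p.
  by apply: contra_eq_neq Np => ->; rewrite mul0r addr0 oner_eq0.
move: (ap); rewrite /a !rmorphM /= !mulf_eq0 !negb_or -!andbA.
move=> /and5P[_ Mp lp _ cp].
(* If [p] divided [v] it would divide [l]; then [u] would be 1 and [H] would be [lc * L ^+ n] modulo
   [p], which is nonzero. *)
have vp : v%:Z%:~R != 0 :> 'F_p.
  apply/eqP => vp0.
  have lp0 : l%:R = 0 :> 'F_p.
    by apply/eqP; move/eqP: vp0; rewrite -[_%:~R]/(v%:R) natrX expf_eq0.
  have : H%:~R = 0 :> 'F_p by rewrite HE rmorphM /= rmorphD rmorphM /= Np mulr0.
  rewrite rmorph_homog /= vp0 homog0 coef_map -lead_coefE -/lc rmorphM LE rmorphM /=.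
  rewrite -[u%:~R]/(u%:R) natrD natrM lp0 mul0r addr0 mulr1 => /eqP.
  by rewrite mulf_eq0 (negPf lp) expf_eq0 mulf_eq0 (negPf ap) (negPf cp) andbF.
exists p; split=> //.
  by rewrite (dvdn_pcharf pc).
exists ((L%:Z * u%:Z)%:~R / v%:Z%:~R); apply/rootP/eqP.
have : H%:~R = 0 :> 'F_p by rewrite HE rmorphM /= rmorphD rmorphM /= Np mulr0.
rewrite rmorph_homog homogE //; last exact: leq_trans (size_poly _ _) sf.
by move/eqP; rewrite mulf_eq0 expf_eq0 (negPf vp) andbF.
Qed.

(** If the constant term is nonzero, its sign is opposite to that of [f] at one of [x] and [y]. *)
Lemma prime_3mod4_root_of_sign_change (f : {poly int}) (x y : realalg) (M : nat) :
  0 < x -> 0 < y -> (map_poly intr f).[x] * (map_poly intr f).[y] < 0 ->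
  (0 < M)%N ->
  exists p, [/\ prime p, (p %% 4 = 3)%N, ~~ (p %| M)%N &
    exists tau : 'F_p, root (map_poly intr f) tau].
Proof.
move=> x0 y0 fxy M0; have [f0|f0] := eqVneq f`_0 0.
  (* Here 0 is a root modulo every prime; [1 - 'X], negative at 2, only supplies a prime. *)
  have [|||p [p1 p2 p3 _]] := @prime_3mod4_root_of_opposite_sign (1 - 'X) 2 M => //.
    have -> : map_poly intr (1 - 'X) = 1 - 'X :> {poly realalg}.
      by rewrite rmorphB rmorph1 /= map_polyX.
    by rewrite coefB coef1 coefX subr0 rmorph1 mul1r hornerD hornerN hornerX hornerC; lra.
  exists p; split=> //; exists 0.
  by rewrite rootE horner_coef0 coef_map /= f0.
have f0' : 0 < (f`_0)%:~R ^+ 2 :> realalg by rewrite exprn_even_gt0 // intr_eq0.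
have [h|h] := ltrP ((f`_0)%:~R * (map_poly intr f).[x]) 0.
  exact: prime_3mod4_root_of_opposite_sign h M0.
apply: prime_3mod4_root_of_opposite_sign y0 _ M0.
have : (f`_0)%:~R ^+ 2 * ((map_poly intr f).[x] * (map_poly intr f).[y]) < 0.
  by rewrite pmulr_rlt0.
rewrite expr2 mulrACA => h2.
by rewrite ltNge; apply: contraTN h2 => h3; rewrite -leNgt mulr_ge0.
Qed.

(** * Reduction modulo a prime *)

(** [A] is a polynomial ring over [int] with one variable per entry of [xs]; the last two clauses
    are its universal property. Positivity serves the brackets, whose ends are fractions of natural
    numbers. *)
Lemma free_ring_specializable (R : realType) (xs : seq R) :
  (forall x, x \in xs -> 0 < x) ->
  exists (A : idomainType) (ev : {rmorphism A -> R}) (g : nat -> A),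
  [/\ forall i, (i < size xs)%N -> ev (g i) = xs`_i,
      real_specializable ev,
      forall (C : comNzRingType) (c : nat -> C),
        exists h : {rmorphism A -> C}, forall i, (i < size xs)%N -> h (g i) = c i
    & forall (C : comNzRingType) (h h' : {rmorphism A -> C}),
        (forall i, (i < size xs)%N -> h (g i) = h' (g i)) -> h =1 h'].
Proof.
elim: xs => [|x xs IH] hx.
  exists int, (intr : {rmorphism _ -> _}), (fun=> 0); split=> //.
  - move=> S U hS hU; exists (intr : {rmorphism _ -> _}); split=> [s|u].
      by move=> /hS/eqP; rewrite /= intr_eq0 => /eqP->.
    by move=> /hU; rewrite /= !ltr0z.
  - by move=> C c; exists (intr : {rmorphism _ -> _}).
  by move=> C h h' _ n; rewrite -[n]intz !rmorph_int.
have [|A [ev [g [evg spA ex un]]]] := IH.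
  by move=> y yxs; apply: hx; rewrite inE yxs orbT.
exists {poly A}, (evalp ev x : {rmorphism _ -> _}).
exists (fun i => if i is j.+1 then (g j)%:P else 'X); split.
- case=> [|i] hi; rewrite /= evalpE; first by rewrite map_polyX hornerX.
  by rewrite map_polyC hornerC /= evg.
- by apply: real_specializable_poly => //; apply: hx; rewrite mem_head.
- move=> C c; have [h hg] := ex C (c \o succn).
  exists (evalp h (c 0%N) : {rmorphism _ -> _}).
  case=> [|i] hi; rewrite /= evalpE; first by rewrite map_polyX hornerX.
  by rewrite map_polyC hornerC /= hg.
- move=> C h h' hg.
  have hC a : h a%:P = h' a%:P.
    apply: (un C (h \o polyC : {rmorphism _ -> _}) (h' \o polyC : {rmorphism _ -> _})).
    by move=> i hi; apply: (hg i.+1).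
  elim/poly_ind => [|p a IHp]; first by rewrite !rmorph0.
  by rewrite !rmorphD !rmorphM /= IHp hC (hg 0%N).
Qed.

Lemma common_denominator (qs : seq {poly rat}) :
  exists (N : int) (ps : seq {poly int}), N != 0 /\
    forall i, N%:~R *: qs`_i = map_poly intr ps`_i.
Proof.
elim: qs => [|q qs [N [ps [N0 hps]]]].
  by exists 1, [::]; split=> // i; rewrite !nth_nil rmorph0 scaler0.
have [p [a a0 ->]] := rat_poly_scale q.
exists (a * N), (N *: p :: [seq a *: r | r <- ps]); split; first by rewrite mulf_neq0.
case=> [|i] /=.
  rewrite map_polyZ /= scalerA rmorphM /= mulrAC divff ?mul1r //.
  by rewrite intr_eq0.
rewrite rmorphM /= -scalerA hps -map_polyZ; congr (map_poly _ _).
have [ip|ip] := ltnP i (size ps); first by rewrite (nth_map 0).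
by rewrite !nth_default ?scaler0 // size_map.
Qed.

Lemma real_algebraic_primitive_element (ys : seq realalg) :
  exists (theta : realalg) (N : int) (ps : seq {poly int}), [/\ 0 < theta, N != 0
    & forall i, N%:~R * ys`_i = (map_poly intr ps`_i).[theta]].
Proof.
pose a := RealAlg.pet_alg ys; pose qs := RealAlg.pet_alg_poly ys.
have qsE i : (map_poly (realalg_of rat) qs`_i).[a] = ys`_i by apply: RealAlg.pet_algK.
(* Shifting the primitive element by [k] makes it positive; composing with ['X - k] undoes the
   shift. *)
pose k := Num.bound a.
have [N [ps [N0 psE]]] := common_denominator [seq q \Po ('X - k%:R%:P) | q <- qs].
exists (a + k%:R), N, ps; split=> //.
  have := archi_boundP (normr_ge0 a); rewrite /k /Num.bound normr_id => h.
  have := ler_norm (- a); rewrite normrN; lra.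
move=> i; have /(congr1 (fun p => (map_poly (realalg_of rat) p).[a + k%:R])) := psE i.
rewrite map_polyZ hornerZ rmorph_int -map_poly_comp /=.
rewrite (eq_map_poly (rmorph_int (realalg_of rat))) => <-.
rewrite -qsE; congr (_ * _); have [ip|ip] := ltnP i (size qs); last first.
  by rewrite !nth_default ?size_map // !rmorph0 !horner0.
rewrite (nth_map 0) // map_comp_poly horner_comp rmorphB /= map_polyX map_polyC /=.
by rewrite !hornerE rmorph_nat addrK.
Qed.

(** A real algebraic specialization has values in the ring generated by [th] and the inverse of [N].
    Modulo [p], [th] goes to a root of its annihilator [f] and [N] stays invertible. *)
Lemma real_specialization_mod_p (R : realType) (xs : seq R) :
  (forall x, x \in xs -> 0 < x) ->
  exists (A : idomainType) (ev : {rmorphism A -> R}) (g : nat -> A),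
  (forall i, (i < size xs)%N -> ev (g i) = xs`_i) /\
  forall (S : seq A) (M : nat), (forall s, s \in S -> ev s = 0) -> (0 < M)%N ->
  exists p, [/\ prime p, (p %% 4 = 3)%N, ~~ (p %| M)%N &
    exists psi : {rmorphism A -> 'F_p}, forall s, s \in S -> psi s = 0].
Proof.
move=> /free_ring_specializable[A [ev [g [evg spA ex un]]]].
exists A, ev, g; split=> // S M evS M0.
have [|phi [phiS _]] := spA S [::] evS; first by [].
have [th [N [ps [th0 N0 psE]]]] :=
  real_algebraic_primitive_element (mkseq (phi \o g) (size xs)).
have [|f [lcf fth f'th fmod]] := @minimal_annihilator int realalg intr th.
  have [p [a a0 pE]] := rat_poly_scale (annul_realalg th).
  have E : map_poly (realalg_of rat) (annul_realalg th) = a%:~R^-1 *: map_poly intr p.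
    rewrite pE map_polyZ fmorphV rmorph_int -map_poly_comp /=.
    by rewrite (eq_map_poly (rmorph_int (realalg_of rat))).
  exists p.
    apply: contraNneq (annul_realalg_neq0 th) => p0.
    by rewrite -(map_poly_eq0 (realalg_of rat)) E p0 scaler0.
  by have := root_annul_realalg th; rewrite E rootZ // invr_eq0 intr_eq0.
have [d d0 hd] := simple_root_sign_change fth f'th.
(* The radius is at most [th] to keep the left end positive. *)
have [|k [l [e [e0 k1 k2 l1 l2]]]] := @rational_bracket realalg th (Num.min d th) th0.
  by rewrite lt_min d0.
have m1 : Num.min d th <= d by rewrite ge_min lexx.
have m2 : Num.min d th <= th by rewrite ge_min lexx orbT.
(* Avoiding [N] and the leading coefficient of [f] keeps both invertible modulo [p]. *)
have [||||p [pp p3 pM [tau ftau]]] := @prime_3mod4_root_of_sign_change f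
  (k%:R / e%:R) (l%:R / e%:R) (M * (`|N| * `|lead_coef f|)).
- by move: k1; lra.
- by move: l1; lra.
- by apply: hd; rewrite ?k2 ?l1 ?andbT /=; lra.
- rewrite !muln_gt0 M0 !absz_gt0 N0; apply: contraNneq lcf => ->.
  by rewrite rmorph0.
move: pM; rewrite !Euclid_dvdM // !negb_or => /and3P[pM pN pf].
have intp n : ~~ (p %| `|n|)%N -> n%:~R != 0 :> 'F_p.
  rewrite (dvdn_pcharf (pchar_Fp pp)); apply: contra => /eqP n0.
  by rewrite -[_%:R]/(`|n|%:Z%:~R) abszE; case: ger0P; rewrite ?rmorphN /= n0 ?oppr0.
exists p; split=> //.
(* The inner variable stands for [th] and the outer one for the inverse of [N], so [sig] lifts
   [phi]. *)
have [sig sigE] := ex {poly {poly int}} (fun i => (ps`_i)%:P * 'X).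
pose Eth := evalp (evalp intr th) (N%:~R^-1 : realalg).
pose Etau := evalp (evalp intr tau) (N%:~R^-1 : 'F_p).
have phiE : phi =1 Eth \o sig.
  apply: (un _ phi (Eth \o sig : {rmorphism _ -> _})) => i hi /=.
  rewrite sigE // /Eth rmorphM /= !evalpE map_polyC map_polyX hornerC hornerX /=.
  by rewrite evalpE -psE nth_mkseq // mulrAC divff ?mul1r // intr_eq0.
exists (Etau \o sig : {rmorphism _ -> _}) => s sS /=.
(* [t] is [sig s] with the inverse of [N] cleared: it vanishes at [th], so its pseudo-remainder by
   [f] is zero and it vanishes at [tau] too. *)
pose n := size (sig s); pose t := homog n (sig s) 1 N%:P.
have homE (K : fieldType) (z : K) : N%:~R != 0 :> K ->
  evalp intr z t = N%:~R ^+ n * evalp (evalp intr z) N%:~R^-1 (sig s).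
  move=> N0'; rewrite rmorph_homog rmorph1 /= [evalp _ _ N%:P]evalpE map_polyC hornerC /=.
  by rewrite homogE ?div1r // (leq_trans (size_poly _ _)).
have tth : evalp intr th t = 0.
  rewrite homE ?intr_eq0 // -/Eth.
  by have := phiE s; rewrite /= phiS // => <-; rewrite mulr0.
have tf : t %% f = 0.
  have := fmod t; rewrite rootE -evalpE tth eqxx => /(_ isT) t0.
  apply/polyP => i; rewrite coef0; apply/eqP.
  have /eqP := congr1 (fun q : {poly realalg} => q`_i) t0.
  by rewrite coef_map coef0 /= intr_eq0.
have : evalp intr tau t = 0.
  have /(congr1 (evalp intr tau)) := Pdiv.Idomain.divp_eq t f.
  rewrite tf addr0 -mul_polyC !rmorphM /= [X in _ = _ * X]evalpE (rootP ftau) mulr0.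
  rewrite evalpE map_polyC hornerC /= => /eqP; rewrite mulf_eq0 => /orP[|/eqP//].
  have lcn : (lead_coef f ^+ scalp t f)%:~R != 0 :> 'F_p.
    by rewrite rmorphXn expf_neq0 // intp.
  by rewrite (negPf lcn).
rewrite homE ?intp // => /eqP; rewrite mulf_eq0 expf_eq0 (negPf (intp _ pN)) andbF.
by move/eqP.
Qed.

Lemma real_specialization_mod_p_fin (R : realType) (I : finType) (x : I -> R) :
  exists (A : idomainType) (ev : {rmorphism A -> R}) (g : I -> A),
  (forall i, ev (g i) = x i) /\
  forall (S : seq A) (M : nat), (forall s, s \in S -> ev s = 0) -> (0 < M)%N ->
  exists p, [/\ prime p, (p %% 4 = 3)%N, ~~ (p %| M)%N &
    exists psi : {rmorphism A -> 'F_p}, forall s, s \in S -> psi s = 0].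
Proof.
(* [real_specialization_mod_p] needs positive generators: recover [x i] from
   [`|x i| + 1] up to sign. *)
pose xs : seq R := [seq `|x i| + 1 | i <- enum I].
have [|A [ev [g [evg spA]]]] := @real_specialization_mod_p R xs.
  by move=> _ /mapP[i _ ->]; rewrite ltr_wpDl.
exists A, ev, (fun i => let h := g (index i (enum I)) - 1 in
  if 0 <= x i then h else - h); split=> // i.
have evh : ev (g (index i (enum I))) - 1 = `|x i|.
  have hi : (index i (enum I) < size (enum I))%N by rewrite index_mem mem_enum.
  have hx : (index i (enum I) < size xs)%N by rewrite size_map.
  by rewrite (evg _ hx) (nth_map i 0 _ hi) nth_index ?mem_enum // addrK.
rewrite /=; case: ifP => xi; rewrite ?rmorphN rmorphB rmorph1 evh.
  by rewrite ger0_norm.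
by rewrite ltr0_norm ?opprK // ltNge xi.
Qed.

(** * Transfer of the frame equations *)

Section HermitianSums.
Context {A : comNzRingType} {I : finType}.
Implicit Types x y u v : I -> A.

(** Real and imaginary parts of the Hermitian product of [x + i y] with [u + i v], kept as
    polynomial expressions so that ring morphisms commute with them. *)
Definition herm_re x y u v : A := \sum_i (x i * u i + y i * v i).
Definition herm_im x y u v : A := \sum_i (x i * v i - y i * u i).

Lemma herm_sumE (iota : A) x y u v : iota ^+ 2 = -1 ->
  \sum_i (x i - iota * y i) * (u i + iota * v i) =
  herm_re x y u v + iota * herm_im x y u v.
Proof.
move=> i2; rewrite mulr_sumr -big_split; apply: eq_bigr => i _ /=.
have -> : y i * v i = - (iota ^+ 2 * (y i * v i)) by rewrite i2 mulN1r opprK.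
ring.
Qed.

Lemma herm_im_diag x y : herm_im x y x y = 0.
Proof. by rewrite /herm_im big1 // => i _; rewrite mulrC subrr. Qed.

Lemma herm_reC x y u v : herm_re u v x y = herm_re x y u v.
Proof. by apply: eq_bigr => i _; ring. Qed.

Lemma herm_imC x y u v : herm_im u v x y = - herm_im x y u v.
Proof. by rewrite -sumrN; apply: eq_bigr => i _; ring. Qed.

End HermitianSums.

Lemma rmorph_herm_re (A B : comNzRingType) (I : finType) (f : {rmorphism A -> B})
    (x y u v : I -> A) :
  f (herm_re x y u v) = herm_re (f \o x) (f \o y) (f \o u) (f \o v).
Proof.
by rewrite rmorph_sum; apply: eq_bigr => i _; rewrite rmorphD !rmorphM.
Qed.

Lemma rmorph_herm_im (A B : comNzRingType) (I : finType) (f : {rmorphism A -> B})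
    (x y u v : I -> A) :
  f (herm_im x y u v) = herm_im (f \o x) (f \o y) (f \o u) (f \o v).
Proof.
by rewrite rmorph_sum; apply: eq_bigr => i _; rewrite rmorphB !rmorphM.
Qed.

(** * The field with p ^ 2 elements and its Frobenius form *)

Lemma sqrt_minus_one_card (F : finFieldType) (p : nat) :
  prime p -> (p %% 4 = 3)%N -> #|F| = (p ^ 2)%N ->
  exists iota : F, iota ^+ 2 = -1 /\ iota ^+ p = - iota.
Proof.
move=> pp p3 cF; have [k pE] : exists k, p = (4 * k + 3)%N.
  by exists (p %/ 4)%N; rewrite {1}(divn_eq p 4) p3 mulnC.
(* [h] and [m] are a quarter and a half of [p ^ 2 - 1]. Some unit has [x ^+ m = -1], as ['X^m - 1]
   has at most [m] roots among the [2 * m] units. *)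
pose h := (2 * (k.+1 * (2 * k + 1)))%N; pose m := (2 * h)%N.
have mE : #|F|.-1 = (m * 2)%N by rewrite cF pE -mulnn /m /h; nia.
have m0 : (0 < m)%N by rewrite /m /h; nia.
have [x x0 xm] : exists2 x : F, x != 0 & x ^+ m != 1.
  have [|hx] := pselect (exists2 x : F, x != 0 & x ^+ m != 1); first by [].
  pose rs := enum (predC1 (0 : F)).
  have q0 : 'X^m - 1 != 0 :> {poly F}.
    by rewrite -size_poly_eq0 size_XnsubC.
  have := max_poly_roots q0 _ (enum_uniq _) (rs := rs).
  rewrite size_XnsubC //.
  rewrite -cardE cardC1.
  rewrite mE => hs; suff /hs : all (root ('X^m - 1)) rs by lia.
  apply/allP => x; rewrite mem_enum inE => x0.
  rewrite rootE !hornerE subr_eq0; apply/negP => xm; apply: hx; exists x => //.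
  exact/negP.
have xm1 : x ^+ m = -1.
  have : (x ^+ m) ^+ 2 = 1.
    rewrite -exprM -mE; apply: (mulfI x0); rewrite mulr1 -exprS prednK ?expf_card //.
    by rewrite cF expn_gt0 prime_gt0.
  by move/eqP; rewrite sqrf_eq1 (negPf xm) => /eqP.
have i2 : (x ^+ h) ^+ 2 = -1 by rewrite -exprM mulnC.
exists (x ^+ h); split=> //.
move: i2; move: (x ^+ h) => i i2.
(* As [i ^+ 4 = 1] and [p = 4 * k + 3], the power is [i ^+ 3]. *)
rewrite pE exprD exprM (exprM i 2 2) i2 sqrrN expr1n expr1n mul1r.
by rewrite exprS i2 mulrN1.
Qed.

Section UnitaryModel.
Context (F : finFieldType) (p : nat).
Hypotheses (pp : prime p) (pF : p \in [pchar F]) (cF : #|F| = (p ^ 2)%N).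

Definition frob_dot d (u v : 'cV[F]_d) : F := \sum_k u k 0 ^+ p * v k 0.

Lemma frobD (x y : F) : (x + y) ^+ p = x ^+ p + y ^+ p.
Proof. by apply: exprDn_pchar; rewrite pnatE. Qed.

Lemma frobK (x : F) : (x ^+ p) ^+ p = x.
Proof. by rewrite -exprM mulnn -cF expf_card. Qed.

Lemma frob_sum (I : Type) (r : seq I) (f : I -> F) :
  (\sum_(i <- r) f i) ^+ p = \sum_(i <- r) f i ^+ p.
Proof.
elim/big_ind2: _ => //; first by rewrite expr0n eqn0Ngt prime_gt0.
by move=> x x2 y y2 <- <-; rewrite frobD.
Qed.

Lemma frob_dot_unitary d : unitary_geometry p (@frob_dot d).
Proof.
split.
- move=> u a v w; rewrite /frob_dot mulr_sumr -big_split; apply: eq_bigr => k _ /=.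
  by rewrite !mxE; ring.
- move=> u v; rewrite /frob_dot frob_sum; apply: eq_bigr => k _.
  by rewrite exprMn frobK mulrC.
- move=> u hu; apply/colP => k; rewrite mxE.
  have := hu (delta_mx k 0); rewrite /frob_dot (bigD1 k) //= big1 => [|j jk].
    rewrite mxE !eqxx mulr1 addr0 => /eqP; rewrite expf_eq0 => /andP[_ /eqP //].
  by rewrite mxE (negPf jk) mulr0.
Qed.

End UnitaryModel.

(** * The frame equations in real coordinates *)

Local Notation rc := (real_complex _).

(** Products of rows encode tightness, products of columns the norms and angles. The rescaling to
    unit norm is cleared by passing from [b] to [b * a ^+ 2], where [a] is the common squared
    norm. *)
Lemma complex_herm_relations (R : realType) (d n : nat) (Phi : 'M[R[i]]_(d, n))
    (X := fun k j => complex.Re (Phi k j)) (Y := fun k j => complex.Im (Phi k j))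
    (gre := fun i j => herm_re (X^~ i) (Y^~ i) (X^~ j) (Y^~ j))
    (gim := fun i j => herm_im (X^~ i) (Y^~ i) (X^~ j) (Y^~ j)) :
  complex_ETF Phi -> exists a b c : R,
  [/\ c != 0,
      forall k l, herm_re (X l) (Y l) (X k) (Y k) = if k == l then c else 0,
      forall k l, herm_im (X l) (Y l) (X k) (Y k) = 0,
      forall j, gre j j = a
    & forall i j, i != j -> gre i j ^+ 2 + gim i j ^+ 2 = b].
Proof.
have i2 : ('i%C : R[i]) ^+ 2 = -1 by exact: sqr_i.
have conjE (z : R[i]) : z^*%C = rc (complex.Re z) - 'i%C * rc (complex.Im z).
  by case: z => x y; simpc.
pose re := @complex.Re R; pose im := @complex.Im R.
have sumE (I : finType) (u v : I -> R[i]) :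
    \sum_i (u i)^*%C * v i =
    rc (herm_re (re \o u) (im \o u) (re \o v) (im \o v)) +
    'i%C * rc (herm_im (re \o u) (im \o u) (re \o v) (im \o v)).
  rewrite rmorph_herm_re rmorph_herm_im -herm_sumE //; apply: eq_bigr => i _.
  by rewrite conjE [v i in LHS]complexE.
have rcE (x y : R) : rc x + 'i%C * rc y = (x +i* y)%C by simpc.
have cdotE i j : cdot (col i Phi) (col j Phi) = (gre i j +i* gim i j)%C.
  rewrite -rcE -(sumE _ (Phi^~ i) (Phi^~ j)) /cdot mxE; apply: eq_bigr => k _.
  by rewrite !mxE.
case=> -[c c0 tight] col0 norm [b b01 equi].
have entry k l : (herm_re (X l) (Y l) (X k) (Y k) +i*
     herm_im (X l) (Y l) (X k) (Y k))%C = if k == l then rc c else 0.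
  rewrite -rcE -(sumE _ (Phi l) (Phi k)).
  have := congr1 (fun M : 'M_d => M k l) tight; rewrite !mxE => E.
  transitivity (rc c *+ (k == l)); last by case: (k == l).
  by rewrite -E; apply: eq_bigr => j _; rewrite !mxE mulrC.
have gdiag i j : gre i i = gre j j.
  have /(congr1 (fun z => z ^+ 2)) := norm i j.
  by rewrite /cnorm !sqrtCK !cdotE => -[].
have [a ha] : exists a, forall j, gre j j = a.
  have [j0 _|no] := pickP (@predT 'I_n); first by exists (gre j0 j0).
  by exists 0 => j; have := no j.
exists a, (b * a ^+ 2), c; split=> //.
- by rewrite gt_eqF.
- move=> k l; have /(congr1 (@complex.Re R)) := entry k l; move=> /= ->.
  by case: (k == l).
- move=> k l; have /(congr1 (@complex.Im R)) := entry k l; move=> /= ->.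
  by case: (k == l).
move=> i j ij; have := equi i j ij.
have cdotZ (r t : R[i]) (u v : 'cV[R[i]]_d) :
    cdot (r *: u) (t *: v) = r^*%C * t * cdot u v.
  rewrite /cdot !mxE mulr_sumr; apply: eq_bigr => k _; rewrite !mxE rmorphM /=.
  by ring.
rewrite /normalize cdotZ (norm j i) cdotE.
set s := cnorm _; set z := (_ +i* _)%C => E.
have s2 : s ^+ 2 = a%:C%C.
  by rewrite sqrtCK cdotE ha [gim i i]herm_im_diag.
have zz : `|z| ^+ 2 = (gre i j ^+ 2 + gim i j ^+ 2)%:C%C.
  rewrite sqr_normc /z; simpc; congr (_ +i* _)%C; ring.
have s4 : (`|s| ^+ 2) ^+ 2 = (a ^+ 2)%:C%C.
  by rewrite -normrX s2 normc_def /= expr0n addr0 -rmorphXn /= sqr_sqrtr // sqr_ge0.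
(* [a] is a sum of real squares, so [a = 0] would make column [i] zero. *)
have a0 : a != 0.
  apply: contra_neq (col0 i) => a0; apply/colP => k; rewrite !mxE.
  have : \sum_k (X k i ^+ 2 + Y k i ^+ 2) = 0.
    by rewrite -[RHS]a0 -(ha i) /gre /herm_re; apply: eq_bigr => l _; rewrite !expr2.
  move/eqP; rewrite psumr_eq0 => [/allP/(_ k (mem_index_enum _))|l _]; last first.
    by rewrite addr_ge0 ?sqr_ge0.
  rewrite /= paddr_eq0 ?sqr_ge0 // !sqrf_eq0 => /andP[/eqP x0 /eqP y0].
  by apply/eqP; rewrite eq_complex [complex.Re _]x0 [complex.Im _]y0 eqxx.
apply: (@complexI R); rewrite -zz rmorphM /= -E -s4.
have s0 : `|s| != 0.
  rewrite normr_eq0; apply: contra_neq a0 => s0; apply: (@complexI R).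
  by rewrite -s2 s0 expr0n.
rewrite !normrM norm_conjC normfV.
by field.
Qed.

(** The entries of [x] and [y] are fixed by the Frobenius map and [iota] is negated, so the [p]-th
    power acts on [x + iota * y] as complex conjugation. *)
Lemma unitary_ETF_of_herm_relations (F : finFieldType) (p d n : nat) (iota a b c : F)
    (x y : 'I_d -> 'I_n -> F)
    (gre := fun i j => herm_re (x^~ i) (y^~ i) (x^~ j) (y^~ j))
    (gim := fun i j => herm_im (x^~ i) (y^~ i) (x^~ j) (y^~ j)) :
  prime p -> p \in [pchar F] -> #|F| = (p ^ 2)%N ->
  iota ^+ 2 = -1 -> iota ^+ p = - iota ->
  (forall k j, in_Fq p (x k j)) -> (forall k j, in_Fq p (y k j)) ->
  in_Fq p a -> in_Fq p b -> in_Fq p c -> c != 0 ->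
  (forall k l, herm_re (x l) (y l) (x k) (y k) = if k == l then c else 0) ->
  (forall k l, herm_im (x l) (y l) (x k) (y k) = 0) ->
  (forall j, gre j j = a) ->
  (forall i j, i != j -> gre i j ^+ 2 + gim i j ^+ 2 = b) ->
  has_unitary_ETF p d n.
Proof.
move=> pp pF cF i2 ip xp yp ap bp cp c0 re im ga gb.
pose phi j : 'cV[F]_d := \col_k (x k j + iota * y k j).
have conjE k j : phi j k 0 ^+ p = x k j - iota * y k j.
  by rewrite mxE frobD // exprMn ip xp yp mulNr.
have dotE i j : frob_dot p (phi i) (phi j) = gre i j + iota * gim i j.
  by rewrite -herm_sumE //; apply: eq_bigr => k _; rewrite conjE mxE.
have tight v : \sum_(j < n) frob_dot p (phi j) v *: phi j = c *: v.
  apply/colP => k; rewrite summxE !mxE.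
  transitivity (\sum_l (if k == l then c else 0) * v l 0); last first.
    rewrite (bigD1 k) //= eqxx big1 ?addr0 // => l lk.
    by rewrite eq_sym (negPf lk) mul0r.
  under eq_bigr => j _ do rewrite mxE /frob_dot mulr_suml.
  rewrite exchange_big; apply: eq_bigr => l _ /=.
  have -> : (if k == l then c else 0) =
      \sum_j (x l j - iota * y l j) * (x k j + iota * y k j).
    by rewrite herm_sumE // re im mulr0 addr0.
  rewrite mulr_suml; by apply: eq_bigr => j _; rewrite conjE mxE; ring.
exists F; split=> //; exists (@frob_dot F p d); split; first exact: frob_dot_unitary.
exists phi; split.
  (* As [c] is invertible, the tightness identity writes each [v] as a combination of the
     [phi j]. *)
  apply/vspaceP => v; rewrite memvf.
  rewrite -[v](scalerK c0) -tight scaler_sumr; apply: memv_suml => j _.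
  by rewrite !memvZ // memv_span // codom_f.
exists a, b, c; split=> //.
- by move=> j; rewrite dotE ga [gim j j]herm_im_diag mulr0 addr0.
- move=> i j ij; rewrite !dotE [gre j i]herm_reC [gim j i]herm_imC -(gb i j ij).
  rewrite -/(gre i j) -/(gim i j).
  transitivity (gre i j ^+ 2 - iota ^+ 2 * gim i j ^+ 2); first by ring.
  by rewrite i2 mulN1r opprK.
Qed.

(** [pPrimeCharType] makes a copy of [F] an algebra over ['F_p]; its structure map is repackaged as
    a morphism into [F] itself. *)
Lemma Fp_embedding (F : fieldType) (p : nat) :
  p \in [pchar F] -> inhabited {rmorphism 'F_p -> F}.
Proof.
move=> pF; pose r : 'F_p -> F := in_alg (pPrimeCharType pF).
have rB : zmod_morphism r by move=> x y; apply: (rmorphB (in_alg (pPrimeCharType pF))).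
have rM : monoid_morphism r.
  split; first exact: (rmorph1 (in_alg (pPrimeCharType pF))).
  by move=> x y; apply: (rmorphM (in_alg (pPrimeCharType pF))).
pose mB := GRing.isZmodMorphism.Build 'F_p F r rB.
pose mM := GRing.isMonoidMorphism.Build 'F_p F r rM.
by constructor; exact: (HB.pack r mB mM : {rmorphism 'F_p -> F}).
Qed.

Lemma in_Fq_rmorph_Fp (F : finFieldType) (p : nat) (f : {rmorphism 'F_p -> F}) z :
  prime p -> in_Fq p (f z).
Proof.
move=> pp.
by rewrite /in_Fq -rmorphXn /= -[X in _ ^+ X](card_Fp pp) expf_card.
Qed.

Theorem theorem7p1 (R : realType) (d n : nat)
    (hETF : exists Phi : 'M[R[i]]_(d, n), complex_ETF Phi) :
  exists Q : set nat,
    [/\ infinite_set Q,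
        forall q q' : nat, Q q -> Q q' -> q <> q' -> coprime q q',
        forall q : nat, Q q -> prime_power q
      & forall q : nat, Q q -> has_unitary_ETF q d n].
Proof.
suff unb (M : nat) : (0 < M)%N ->
    exists p, [/\ prime p, ~~ (p %| M)%N & has_unitary_ETF p d n].
  exists (fun q => prime q /\ has_unitary_ETF q d n); split.
  - move=> /finite_seqP[s sE].
    (* Every positive member of [s] divides this factorial, so the new prime is outside [s]. *)
    have [p [pp /negP pM hp]] := unb ((\max_(q <- s) q)`!) (fact_gt0 _).
    have : p \in s by have : [set` s]%classic p by rewrite -sE.
    move=> ps; apply: pM; rewrite dvdn_fact // prime_gt0 //=.
    by rewrite (leq_bigmax_seq (F := id)).
  - by move=> q q' [qp _] [q'p _] /eqP qq'; rewrite prime_coprime // dvdn_prime2.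
  - by move=> q [qp _]; exists q, 1%N; rewrite expn1.
  - by move=> q [].
move=> M0; case: hETF => Phi /complex_herm_relations[a [b [c [c0 re im ga gb]]]].
pose I : finType := ('I_d * 'I_n * bool + 'I_4)%type.
(* The inverse of [c] is among the transferred values so that the equation [c * c^-1 = 1] keeps [c]
   nonzero in [F]. *)
pose x (i : I) : R := match i with
  | inl (k, j, true) => complex.Re (Phi k j)
  | inl (k, j, false) => complex.Im (Phi k j)
  | inr o => [:: a; b; c; c^-1]`_o end.
have [A [ev [g [evg spA]]]] := real_specialization_mod_p_fin x.
pose X k j := g (inl (k, j, true)); pose Y k j := g (inl (k, j, false)).
pose t o : A := g (inr (inord o)).
have evt o : (o < 4)%N -> ev (t o) = [:: a; b; c; c^-1]`_o.
  by move=> o4; rewrite evg /x inordK.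
pose gre i j := herm_re (X^~ i) (Y^~ i) (X^~ j) (Y^~ j).
pose gim i j := herm_im (X^~ i) (Y^~ i) (X^~ j) (Y^~ j).
pose r1 (kl : 'I_d * 'I_d) := let: (k, l) := kl in
  herm_re (X l) (Y l) (X k) (Y k) - if k == l then t 2%N else 0.
pose r2 (kl : 'I_d * 'I_d) := let: (k, l) := kl in
  herm_im (X l) (Y l) (X k) (Y k).
pose r3 j := gre j j - t 0%N.
pose r4 (ij : 'I_n * 'I_n) := let: (i, j) := ij in
  if i != j then gre i j ^+ 2 + gim i j ^+ 2 - t 1%N else 0.
pose S := (t 2%N * t 3%N - 1) :: codom r1 ++ codom r2 ++ codom r3 ++ codom r4.
have [|p [pp p3 pM [psi psiS]]] := spA S M _ M0.
  move=> s; rewrite inE !mem_cat => /orP[/eqP->|/or4P[]/codomP].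
  - by rewrite rmorphB rmorphM rmorph1 /= !evt //= divff ?subrr.
  - move=> [[k l] ->]; rewrite rmorphB rmorph_herm_re /=.
    rewrite (_ : herm_re _ _ _ _ = if k == l then c else 0).
      by case: (k == l); rewrite ?evt ?rmorph0 //= subrr.
    by rewrite -re; apply: eq_bigr => j _; rewrite /= !evg.
  - move=> [[k l] ->]; rewrite rmorph_herm_im -[RHS](im k l).
    by apply: eq_bigr => j _; rewrite /= !evg.
  - move=> [j ->]; rewrite rmorphB rmorph_herm_re /= evt //= -(ga j).
    by apply/eqP; rewrite subr_eq0; apply/eqP/eq_bigr => k _; rewrite /= !evg.
  - move=> [[i j] ->]; rewrite /r4; case: ifP => [ij|_]; last by rewrite rmorph0.
    rewrite rmorphB rmorphD !rmorphXn /= rmorph_herm_re rmorph_herm_im evt //=.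
    rewrite -(gb i j ij); apply/eqP; rewrite subr_eq0; apply/eqP.
    by congr (_ ^+ 2 + _ ^+ 2); apply: eq_bigr => k _; rewrite /= !evg.
have [F pF cF] := pPrimePowerField pp (isT : 0 < 2)%N.
have [rho] := Fp_embedding pF.
have [iota [i2 ip]] := sqrt_minus_one_card pp p3 cF.
(* Factoring through ['F_p] makes all values of [f] fixed by the Frobenius map. *)
pose f : {rmorphism A -> F} := rho \o psi.
have fS s : s \in S -> f s = 0 by move=> sS; rewrite /f /= psiS ?rmorph0.
have fp z : in_Fq p (f z) by apply: in_Fq_rmorph_Fp.
exists p; split=> //.
have fr1 k l : f (r1 (k, l)) = 0.
  by apply: fS; rewrite /S inE !mem_cat codom_f orbT.
have fr2 k l : f (r2 (k, l)) = 0.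
  by apply: fS; rewrite /S inE !mem_cat codom_f !orbT.
have fr3 j : f (r3 j) = 0.
  by apply: fS; rewrite /S inE !mem_cat codom_f !orbT.
have fr4 i j : f (r4 (i, j)) = 0.
  by apply: fS; rewrite /S inE !mem_cat codom_f !orbT.
apply: (@unitary_ETF_of_herm_relations F p d n iota (f (t 0%N)) (f (t 1%N)) (f (t 2%N))
  (fun k j => f (X k j)) (fun k j => f (Y k j))) => //.
- apply: contraNneq (oner_neq0 F) => t20.
  have : f (t 2%N * t 3%N - 1) = 0 by apply: fS; rewrite mem_head.
  by rewrite rmorphB rmorphM rmorph1 t20 mul0r sub0r => /eqP; rewrite oppr_eq0.
- move=> k l; have := fr1 k l; rewrite rmorphB rmorph_herm_re => /subr0_eq ->.
  by case: (k == l); rewrite ?rmorph0.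
- by move=> k l; have := fr2 k l; rewrite rmorph_herm_im.
- by move=> j; have := fr3 j; rewrite rmorphB rmorph_herm_re => /subr0_eq.
- move=> i j ij; have := fr4 i j; rewrite /r4 ij rmorphB rmorphD !rmorphXn.
  by rewrite rmorph_herm_re rmorph_herm_im => /subr0_eq h; exact: h.
Qed.
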